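(* For any sets $\Gamma$ and $\Theta$ of formulas, the following are equivalent over $\mathsf{HA}$: (1) $(\Gamma,\Theta)\text{-}\mathbf{DML}$; (2) $(\Gamma^{\mathrm n}\lor\Theta^{\mathrm n})\text{-}\mathbf{DNE}$. The analogous equivalences also hold when $\Gamma$ and/or $\Theta$ is replaced by $\Delta_k$ or $\Delta_k^{\mathrm n}$ ($k\ge0$). That is, for $A,B$ each being either a set of formulas or one of the symbols $\Delta_k,\Delta_k^{\mathrm n}$, the principles $(A,B)\text{-}\mathbf{DML}$ and $(A^{\mathrm n}\lor B^{\mathrm n})\text{-}\mathbf{DNE}$ are equivalent over $\mathsf{HA}$.
   Context: $\mathsf{HA}$ is first-order intuitionistic (Heyting) arithmetic with connectives $\land,\lor,\to,\exists,\forall,\bot$ ($\neg\varphi$ abbreviates $\varphi\to\bot$), with function symbols for all primitive recursive functions and their defining equations, basic arithmetic axioms, and the full induction scheme. Formulas may contain free variables. Classes: $\Sigma_0=\Pi_0$ is the set of quantifier-free formulas; $\Sigma_{k+1}=\{\exists x_1\cdots\exists x_n\varphi : \varphi\in\Pi_k,\ n\ge1\}$; $\Pi_{k+1}=\{\forall x_1\cdots\forall x_n\varphi : \varphi\in\Sigma_k,\ n\ge 1\}$. $\Gamma^{\mathrm n}=\{\neg\varphi:\varphi\in\Gamma\}$; $\Gamma\lor\Theta=\{\varphi\lor\psi:\varphi\in\Gamma,\psi\in\Theta\}$. Principles: $(\Gamma,\Theta)\text{-}\mathbf{DML}$: $\neg(\varphi\land\psi)\to\neg\varphi\lor\neg\psi$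 ($\varphi\in\Gamma$, $\psi\in\Theta$). $\Gamma\text{-}\mathbf{DNE}$: $\neg\neg\varphi\to\varphi$ ($\varphi\in\Gamma$). $\Delta_k$ versions: $\Delta_k$ is not a set of formulas; when a component is $\Delta_k$, the corresponding formula ranges over $\varphi\in\Sigma_k$ and the instance is prefixed with the hypothesis $\varphi\leftrightarrow\varphi'$ for an arbitrary $\varphi'\in\Pi_k$ (one such hypothesis for each $\Delta_k$-type component, the hypotheses being conjoined); when the component is $\Delta_k^{\mathrm n}$ (resp. $(\Delta_k^{\mathrm n})^{\mathrm n}$), the hypothesis is the same and $\varphi$ is replaced by $\neg\varphi$ (resp. $\neg\neg\varphi$) in the body of the instance. For example, $(\Delta_k,\Theta)\text{-}\mathbf{DML}$ is $(\varphi\leftrightarrow\varphi')\to(\neg(\varphi\land\psi)\to\neg\varphi\lor\neg\psi)$, and $(\Delta_k^{\mathrm n}\lor\Theta^{\mathrm n})\text{-}\mathbf{DNE}$ is $(\varphi\leftrightarrow\varphi')\to(\neg\neg(\neg\varphi\lor\neg\psi)\to\neg\varphi\lor\neg\psi)$ ($\varphi\in\Sigma_k$, $\varphi'\in\Pi_k$, $\psi\in\Theta$). For a principle $P$, $\mathsf{HA}+P$ is $\mathsf{HA}$ with the universal closures of all instances of $P$ added as axioms. $P$ and $Q$ are equivalent over $\mathsf{HA}$ if $\mathsf{HA}+P$ proves all instances of $Q$ and $\mathsf{HA}+Q$ proves all instances of $P$. *)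

(* Defs.v *)
From Stdlib Require Import List Arith.
From Stdlib Require Fin Vector.
Import ListNotations.

Set Implicit Arguments.

(* One function symbol for each primitive recursive definition.  The
   recursion argument of [PRec g h] comes first:
   f(0,xs) = g(xs) and f(y+1,xs) = h(y,f(y,xs),xs).  *)
Inductive prf : nat -> Type :=
| PZero : prf 0
| PSucc : prf 1
| PProj : forall n, Fin.t n -> prf n
| PComp : forall m n, prf m -> Vector.t (prf n) m -> prf n
| PRec  : forall n, prf n -> prf (S (S n)) -> prf (S n).

(* Variables are de Bruijn indices, so formulas are taken up to renaming of
   bound variables; an index pointing beyond all binders is a free variable. *)
Inductive term : Type :=
| Var : nat -> term
| App : forall n, prf n -> Vector.t term n -> term.

Inductive form : Type :=
| Bot : form
| Eq  : term -> term -> form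
| And : form -> form -> form
| Or  : form -> form -> form
| Imp : form -> form -> form
| All : form -> form
| Ex  : form -> form.

Definition Neg (p : form) : form := Imp p Bot.
Definition Iff (p q : form) : form := And (Imp p q) (Imp q p).

Definition tZero : term := App PZero (Vector.nil term).
Definition tSucc (t : term) : term :=
  App PSucc (Vector.cons term t 0 (Vector.nil term)).

Fixpoint tsubst (s : nat -> term) (t : term) : term :=
  match t with
  | Var x => s x
  | App f ts => App f (Vector.map (tsubst s) ts)
  end.

Definition shift (x : nat) : term := Var (S x).

Definition scons (t : term) (s : nat -> term) (x : nat) : term :=
  match x with 0 => t | S y => s y end.

Definition up (s : nat -> term) : nat -> term :=
  scons (Var 0) (fun x => tsubst shift (s x)).

Fixpoint fsubst (s : nat -> term) (p : form) : form :=
  match p with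
  | Bot => Bot
  | Eq t u => Eq (tsubst s t) (tsubst s u)
  | And p q => And (fsubst s p) (fsubst s q)
  | Or p q => Or (fsubst s p) (fsubst s q)
  | Imp p q => Imp (fsubst s p) (fsubst s q)
  | All p => All (fsubst (up s) p)
  | Ex p => Ex (fsubst (up s) p)
  end.

Definition inst (t : term) (p : form) : form := fsubst (scons t Var) p.
Definition lift (p : form) : form := fsubst shift p.

(* The least n such that all free variables have index < n. *)
Fixpoint tbound (t : term) : nat :=
  match t with
  | Var x => S x
  | App _ ts => Vector.fold_right (fun u b => Nat.max (tbound u) b) ts 0
  end.

Fixpoint fbound (p : form) : nat :=
  match p with
  | Bot => 0
  | Eq t u => Nat.max (tbound t) (tbound u)
  | And p q | Or p q | Imp p q => Nat.max (fbound p) (fbound q)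
  | All p | Ex p => Nat.pred (fbound p)
  end.

Definition closure (p : form) : form := Nat.iter (fbound p) All p.

(* [T] is a set of axioms.  It is used without lifting under quantifiers,
   which is sound because it will only ever consist of sentences. *)
Inductive prv (T : form -> Prop) : list form -> form -> Prop :=
| prv_ax G p : T p -> prv T G p
| prv_hyp G p : In p G -> prv T G p
| prv_botE G p : prv T G Bot -> prv T G p
| prv_andI G p q : prv T G p -> prv T G q -> prv T G (And p q)
| prv_andE1 G p q : prv T G (And p q) -> prv T G p
| prv_andE2 G p q : prv T G (And p q) -> prv T G q
| prv_orI1 G p q : prv T G p -> prv T G (Or p q)
| prv_orI2 G p q : prv T G q -> prv T G (Or p q)
| prv_orE G p q r :
    prv T G (Or p q) -> prv T (p :: G) r -> prv T (q :: G) r -> prv T G r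
| prv_impI G p q : prv T (p :: G) q -> prv T G (Imp p q)
| prv_impE G p q : prv T G (Imp p q) -> prv T G p -> prv T G q
| prv_allI G p : prv T (map lift G) p -> prv T G (All p)
| prv_allE G p t : prv T G (All p) -> prv T G (inst t p)
| prv_exI G p t : prv T G (inst t p) -> prv T G (Ex p)
| prv_exE G p q :
    prv T G (Ex p) -> prv T (p :: map lift G) (lift q) -> prv T G q.

(* Open forms of the axioms; [theory] below takes their universal closures. *)
Inductive HA_axiom : form -> Prop :=
| HA_refl t : HA_axiom (Eq t t)
| HA_leibniz t u p : HA_axiom (Imp (Eq t u) (Imp (inst t p) (inst u p)))
| HA_succ_neq0 t : HA_axiom (Neg (Eq (tSucc t) tZero))
| HA_succ_inj t u : HA_axiom (Imp (Eq (tSucc t) (tSucc u)) (Eq t u))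
| HA_proj n (i : Fin.t n) (ts : Vector.t term n) :
    HA_axiom (Eq (App (PProj i) ts) (Vector.nth ts i))
| HA_comp m n (g : prf m) (hs : Vector.t (prf n) m) (ts : Vector.t term n) :
    HA_axiom (Eq (App (PComp g hs) ts)
                 (App g (Vector.map (fun h => App h ts) hs)))
| HA_rec0 n (g : prf n) (h : prf (S (S n))) (ts : Vector.t term n) :
    HA_axiom (Eq (App (PRec g h) (Vector.cons term tZero n ts)) (App g ts))
| HA_recS n (g : prf n) (h : prf (S (S n))) (t : term)
    (ts : Vector.t term n) :
    HA_axiom
      (Eq (App (PRec g h) (Vector.cons term (tSucc t) n ts))
          (App h (Vector.cons term t (S n)
                   (Vector.cons term
                      (App (PRec g h) (Vector.cons term t n ts)) n ts))))
| HA_ind p :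
    HA_axiom
      (Imp (inst tZero p)
           (Imp (All (Imp p (fsubst (scons (tSucc (Var 0)) shift) p)))
                (All p))).

(* A principle is identified with the set of its instances, which may have
   free variables. *)
Definition principle := form -> Prop.

Definition theory (P : principle) (p : form) : Prop :=
  exists q, (HA_axiom q \/ P q) /\ p = closure q.

Definition HA_plus_proves (P : principle) (p : form) : Prop :=
  prv (theory P) [] p.

Definition HA_equivalent (P Q : principle) : Prop :=
  (forall q, Q q -> HA_plus_proves P q) /\
  (forall p, P p -> HA_plus_proves Q p).

Definition fset := form -> Prop.

Fixpoint quantifier_free (p : form) : Prop :=
  match p with
  | Bot | Eq _ _ => True
  | And p q | Or p q | Imp p q => quantifier_free p /\ quantifier_free q
  | All _ | Ex _ => False
  end.

Fixpoint Sigma (k : nat) : fset :=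
  match k with
  | 0 => quantifier_free
  | S k => fun p => exists n q, 1 <= n /\ Pi k q /\ p = Nat.iter n Ex q
  end
with Pi (k : nat) : fset :=
  match k with
  | 0 => quantifier_free
  | S k => fun p => exists n q, 1 <= n /\ Sigma k q /\ p = Nat.iter n All q
  end.

Definition set_neg (C : fset) : fset := fun p => exists q, C q /\ p = Neg q.

Definition set_or (C D : fset) : fset :=
  fun p => exists q r, C q /\ D r /\ p = Or q r.

Definition dml_body (p q : form) : form :=
  Imp (Neg (And p q)) (Or (Neg p) (Neg q)).

Definition dne_body (p : form) : form := Imp (Neg (Neg p)) p.

Definition DML (C D : fset) : principle :=
  fun i => exists p q, C p /\ D q /\ i = dml_body p q.

Definition DNE (C : fset) : principle :=
  fun i => exists p, C p /\ i = dne_body p.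

(* [A hs p]: the formula p may be used in the body of an instance provided
   the instance is prefixed with the hypotheses hs. *)
Definition guarded := list form -> form -> Prop.

Definition g_set (C : fset) : guarded := fun hs p => hs = [] /\ C p.

Definition g_delta (k : nat) : guarded :=
  fun hs p => exists p', Sigma k p /\ Pi k p' /\ hs = [Iff p p'].

Definition g_neg (A : guarded) : guarded :=
  fun hs p => exists q, A hs q /\ p = Neg q.

Definition g_or (A B : guarded) : guarded :=
  fun hs p => exists hs1 hs2 q r,
    A hs1 q /\ B hs2 r /\ hs = hs1 ++ hs2 /\ p = Or q r.

Fixpoint conj_from (h : form) (hs : list form) : form :=
  match hs with [] => h | h' :: hs' => And h (conj_from h' hs') end.

Definition guard (hs : list form) (p : form) : form :=
  match hs with [] => p | h :: hs' => Imp (conj_from h hs') p end.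

Definition g_DML (A B : guarded) : principle :=
  fun i => exists hs1 hs2 p q,
    A hs1 p /\ B hs2 q /\ i = guard (hs1 ++ hs2) (dml_body p q).

Definition g_DNE (A : guarded) : principle :=
  fun i => exists hs p, A hs p /\ i = guard hs (dne_body p).

Inductive component : Type :=
| CSet : fset -> component
| CDelta : nat -> component
| CDeltaN : nat -> component.

Definition interp (A : component) : guarded :=
  match A with
  | CSet C => g_set C
  | CDelta k => g_delta k
  | CDeltaN k => g_neg (g_delta k)
  end.

(* Main.v *)
Require Import Defs.
From Stdlib Require Import List Arith Lia.
From Stdlib Require Vector.
Import ListNotations.

(** Intuitionistic logic proves that [Neg (And p q)] is equivalent to
    [Neg (Neg (Or (Neg p) (Neg q)))].  De Morgan's law for [p] and [q] and
    double negation elimination for [Or (Neg p) (Neg q)] have therefore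
    equivalent hypotheses and the same conclusion, so they imply each other
    instance by instance ([dne_of_dml], [dml_of_dne]), whatever classes [p] and
    [q] come from.  The guards coming from Delta
    components are the same list on both sides, and an implication between two
    bodies passes through a common guard.

    The remaining point is syntactic: the added axioms are universal closures,
    while the instances to be derived are open formulas.  A formula follows
    from its closure by instantiating each closing quantifier with the variable
    that it binds ([prv_closure_elim]).  Eliminating the quantifiers one at a time
    produces a composite of substitutions, which has to be recognised as the
    identity on the free variables. *)

(** * Substitution *)

(** The induction principle generated for [term] gives no hypothesis for the
    arguments inside the vector. *)
Lemma term_nested_ind (P : term -> Prop) :
  (forall x, P (Var x)) ->
  (forall n (f : prf n) ts, Vector.Forall P ts -> P (App f ts)) ->
  forall t, P t.
Proof.
  intros HVar HApp. fix IH 1. intros [x | n f ts].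
  - apply HVar.
  - apply HApp. clear f. induction ts; constructor; auto.
Qed.

Lemma tsubst_id s t :
  (forall x, x < tbound t -> s x = Var x) -> tsubst s t = t.
Proof.
  induction t as [x | n f ts IH] using term_nested_ind; simpl; intros Hs.
  - apply Hs. lia.
  - f_equal. clear f.
    induction IH as [| n t ts Ht _ IHts]; simpl in *; auto.
    f_equal; [apply Ht | apply IHts]; intros x Hx; apply Hs; lia.
Qed.

(** In this lemma and its analogue for formulas the composite [u] is only
    required to agree pointwise with its value, so that the induction on
    formulas goes under binders without function extensionality. *)
Lemma tsubst_tsubst s r u t :
  (forall x, tsubst r (s x) = u x) -> tsubst r (tsubst s t) = tsubst u t.
Proof.
  intros Hu. induction t as [x | n f ts IH] using term_nested_ind; simpl; auto.
  f_equal. clear f. induction IH; simpl; f_equal; auto.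
Qed.

Lemma fsubst_id p : forall s,
  (forall x, x < fbound p -> s x = Var x) -> fsubst s p = p.
Proof.
  assert (Hup : forall n s, (forall x, x < Nat.pred n -> s x = Var x) ->
                forall x, x < n -> up s x = Var x).
  { intros n s Hs [| x] Hx; simpl; auto. rewrite Hs by lia. reflexivity. }
  induction p; simpl; intros s Hs; f_equal;
    try (apply tsubst_id; intros x Hx; apply Hs; lia);
    try (apply IHp1; intros x Hx; apply Hs; lia);
    try (apply IHp2; intros x Hx; apply Hs; lia);
    solve [reflexivity | apply IHp, Hup, Hs].
Qed.

Lemma fsubst_fsubst p : forall s r u,
  (forall x, tsubst r (s x) = u x) -> fsubst r (fsubst s p) = fsubst u p.
Proof.
  assert (Hup : forall s r u, (forall x, tsubst r (s x) = u x) ->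
                forall x, tsubst (up r) (up s x) = up u x).
  { intros s r u Hu [| x]; simpl; auto.
    rewrite <- Hu.
    (* Both sides are [s x] followed by [r] and then [shift]. *)
    rewrite (tsubst_tsubst r shift (fun y => tsubst shift (r y))) by auto.
    apply tsubst_tsubst. reflexivity. }
  induction p; simpl; intros s r u Hu; f_equal; auto using tsubst_tsubst.
Qed.

Lemma inst_fsubst_up s t p :
  inst t (fsubst (up s) p) = fsubst (scons t s) p.
Proof.
  apply fsubst_fsubst. intros [| x]; simpl; auto.
  rewrite (tsubst_tsubst shift (scons t Var) Var) by reflexivity.
  apply tsubst_id. reflexivity.
Qed.

(** * Removing a universal closure *)

(** Eliminating [n] outer quantifiers substitutes arbitrary terms for the
    first [n] indices, while the indices beyond them drop by [n]. *)
Lemma prv_iter_allE T G n : forall p s,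
  (forall x, s (n + x) = Var x) ->
  prv T G (Nat.iter n All p) -> prv T G (fsubst s p).
Proof.
  induction n as [| n IH]; intros p s Hs H.
  - rewrite fsubst_id by (intros x _; apply Hs). exact H.
  - rewrite Nat.iter_succ_r in H.
    apply (IH _ (fun x => s (S x))) in H; [| exact Hs].
    apply prv_allE with (t := s 0) in H. rewrite inst_fsubst_up in H.
    (* [s] is only pointwise equal to [scons (s 0) (fun x => s (S x))]. *)
    replace (fsubst s p) with (fsubst (scons (s 0) (fun x => s (S x))) p);
      [exact H |].
    rewrite <- (fsubst_id p Var) at 1 by reflexivity.
    apply fsubst_fsubst. intros [| x]; reflexivity.
Qed.

Lemma prv_closure_elim T G p : prv T G (closure p) -> prv T G p.
Proof.
  intros H.
  (* The identity below [fbound p]; the remaining values are imposed by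
     [prv_iter_allE] and concern no variable of [p]. *)
  set (s x := if x <? fbound p then Var x else Var (x - fbound p)).
  rewrite <- (fsubst_id p s).
  - apply (prv_iter_allE T G (fbound p)); [| exact H].
    intros x. unfold s. destruct (Nat.ltb_spec (fbound p + x) (fbound p)).
    + lia.
    + f_equal. lia.
  - intros x Hx. unfold s. destruct (Nat.ltb_spec x (fbound p)); auto. lia.
Qed.

(** * De Morgan's law and double negation elimination *)

Ltac hyp := apply prv_hyp; simpl; auto 6.

Lemma dne_of_dml T G p q :
  prv T G (Imp (dml_body p q) (dne_body (Or (Neg p) (Neg q)))).
Proof.
  unfold dml_body, dne_body. do 2 apply prv_impI.
  apply prv_impE with (Neg (And p q)); [hyp |]. apply prv_impI.
  apply prv_impE with (Neg (Or (Neg p) (Neg q))); [hyp |]. apply prv_impI.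
  apply prv_orE with (Neg p) (Neg q); [hyp | |].
  - apply prv_impE with p; [hyp |]. apply prv_andE1 with q. hyp.
  - apply prv_impE with q; [hyp |]. apply prv_andE2 with p. hyp.
Qed.

(** To refute [Neg (Or (Neg p) (Neg q))] given [Neg (And p q)]: it suffices to
    derive [Neg q], and once [q] is assumed it suffices to derive [Neg p], which
    then follows from [Neg (And p q)]. *)
Lemma dml_of_dne T G p q :
  prv T G (Imp (dne_body (Or (Neg p) (Neg q))) (dml_body p q)).
Proof.
  unfold dml_body, dne_body. do 2 apply prv_impI.
  apply prv_impE with (Neg (Neg (Or (Neg p) (Neg q)))); [hyp |].
  apply prv_impI.
  apply prv_impE with (Or (Neg p) (Neg q)); [hyp |].
  apply prv_orI2, prv_impI.
  apply prv_impE with (Or (Neg p) (Neg q)); [hyp |].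
  apply prv_orI1, prv_impI.
  apply prv_impE with (And p q); [hyp |].
  apply prv_andI; hyp.
Qed.

(** The implication is assumed in every context so that it can be applied with
    the guard among the hypotheses. *)
Lemma HA_plus_proves_guard (P : principle) hs p q :
  P (guard hs p) -> (forall G, prv (theory P) G (Imp p q)) ->
  HA_plus_proves P (guard hs q).
Proof.
  intros HP Hpq.
  assert (Hp : HA_plus_proves P (guard hs p)).
  { apply prv_closure_elim, prv_ax. exists (guard hs p). auto. }
  destruct hs as [| h hs]; apply prv_impE with (2 := Hp); simpl; auto.
  do 2 apply prv_impI. apply prv_impE with p; auto.
  apply prv_impE with (conj_from h hs); hyp.
Qed.

Lemma g_DML_equivalent_g_DNE (A B : guarded) :
  HA_equivalent (g_DML A B) (g_DNE (g_or (g_neg A) (g_neg B))).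
Proof.
  split.
  - intros i (hs & d & (hs1 & hs2 & np & nq & (p & Hp & ->) & (q & Hq & ->)
                        & -> & ->) & ->).
    apply HA_plus_proves_guard with (dml_body p q).
    + exists hs1, hs2, p, q. auto.
    + intros G. apply dne_of_dml.
  - intros i (hs1 & hs2 & p & q & Hp & Hq & ->).
    apply HA_plus_proves_guard with (dne_body (Or (Neg p) (Neg q))).
    + exists (hs1 ++ hs2), (Or (Neg p) (Neg q)). split; [| reflexivity].
      exists hs1, hs2, (Neg p), (Neg q). unfold g_neg. repeat split; eauto.
    + intros G. apply dml_of_dne.
Qed.

Lemma DML_equivalent_DNE (C D : fset) :
  HA_equivalent (DML C D) (DNE (set_or (set_neg C) (set_neg D))).
Proof.
  split.
  - intros i (d & (np & nq & (p & Hp & ->) & (q & Hq & ->) & ->) & ->).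
    apply (HA_plus_proves_guard _ [] (dml_body p q)).
    + exists p, q. auto.
    + intros G. apply dne_of_dml.
  - intros i (p & q & Hp & Hq & ->).
    apply (HA_plus_proves_guard _ [] (dne_body (Or (Neg p) (Neg q)))).
    + exists (Or (Neg p) (Neg q)). split; [| reflexivity].
      exists (Neg p), (Neg q). unfold set_neg. repeat split; eauto.
    + intros G. apply dml_of_dne.
Qed.

Theorem proposition6p1 :
  (forall C D : fset,
     HA_equivalent (DML C D) (DNE (set_or (set_neg C) (set_neg D)))) /\
  (forall A B : component,
     HA_equivalent (g_DML (interp A) (interp B))
                   (g_DNE (g_or (g_neg (interp A)) (g_neg (interp B))))).
Proof.
  split.
  - exact DML_equivalent_DNE.
  - intros A B. apply g_DML_equivalent_g_DNE.
Qed.
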